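(* Let $T$ be a complete first order theory. The following are equivalent: (1) $T$ does not have $SOP_1$; (2) $T$ does not have $SOP'_1$; (3) $\mathrm{rk}^1_\varphi(\bar x=\bar x,\ \bar y=\bar y)$ is finite for every formula $\varphi(\bar x,\bar y)$.
   Context: $\mathfrak C$ is the monster model of $T$ (a $\kappa^*$-saturated and homogeneous model for a big enough $\kappa^*$). Notation: ${}^{\omega>}2$, ${}^\omega2$ are the sets of $0$-$1$ sequences of finite length and of length $\omega$; $\nu\trianglelefteq\eta$ means $\nu$ is an initial segment of $\eta$; $\frown$ is concatenation; $\eta\restriction n$ is the initial segment of length $n$; $\varphi^1=\varphi$ and $\varphi^0=\neg\varphi$. $T$ has $SOP_1$ if for some formula $\varphi(\bar x,\bar y)$ there are $\bar a_\eta\in\mathfrak C$ ($\eta\in{}^{\omega>}2$) such that (a) for every $\rho\in{}^\omega2$ the set $\{\varphi(\bar x,\bar a_{\rho\restriction n}):n<\omega\}$ is consistent; (b) if $\nu\frown\langle0\rangle\trianglelefteq\eta\in{}^{\omega>}2$, then $\{\varphi(\bar x,\bar a_\eta),\varphi(\bar x,\bar a_{\nu\frown\langle1\rangle})\}$ is inconsistent. $T$ has $SOP'_1$ if for some formula $\varphi(\bar x,\bar y)$ there are $\bar a_\eta\in\mathfrak C$ ($\eta\in{}^{\omega>}2$) such that (a) $\{\varphi^{\eta(n)}(\bar x,\bar a_{\eta\restriction n}):n<\omega\}$ is consistent for every $\eta\in{}^\omega2$; (b) if $\nu\frown\langle0\rangle\trianglelefteq\eta\in{}^{\omega>}2$,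 then $\{\varphi(\bar x,\bar a_\eta),\varphi(\bar x,\bar a_\nu)\}$ is inconsistent. Rank. For (partial) types $p(\bar x),q(\bar y)$ with parameters in $\mathfrak C$ define by induction on $n<\omega$ when $\mathrm{rk}^1_\varphi(p,q)\ge n$: $\mathrm{rk}^1_\varphi(p,q)\ge0$ iff both $p$ and $q$ are consistent; $\mathrm{rk}^1_\varphi(p,q)\ge n+1$ iff for some $\bar c\models q(\bar y)$ both $\mathrm{rk}^1_\varphi(p\cup\{\varphi(\bar x,\bar c)\},q)\ge n$ and $\mathrm{rk}^1_\varphi\big(p,\ q\cup\{\neg(\exists\bar x)(\varphi(\bar x,\bar y)\wedge\varphi(\bar x,\bar c))\}\big)\ge n$. The rank is $\infty$ iff it is $\ge n$ for all $n$ (otherwise it is finite), and is $-1$ if it is not $\ge0$. Here $\bar x=\bar x$ and $\bar y=\bar y$ stand for the trivial types. *)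

(* Defs.v *)
From mathcomp Require Import all_boot.
From mathcomp Require Import boolp classical_sets functions cardinality.

Set Implicit Arguments.
Unset Strict Implicit.
Unset Printing Implicit Defensive.

Local Open Scope classical_set_scope.
Local Open Scope card_scope.

Definition card_lt (T U : Type) (A : set T) (B : set U) : Prop :=
  A #<= B /\ ~ (B #<= A).

Record language := Language {
  fsym : Type;
  farity : fsym -> nat;
  rsym : Type;
  rarity : rsym -> nat
}.

(* Terms and formulas are indexed by the type V of their possible free
   variables.  Parameters from a structure C are handled by taking
   V = 'I_n + C, where [inr c] is interpreted as c itself. *)
Inductive term (L : language) (V : Type) : Type :=
  | Var of V
  | App (f : fsym L) of ('I_(farity f) -> term L V).
Arguments Var {L V}.
Arguments App {L V}.

(* In [Ex phi] the variable [None] is bound. *)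
Inductive formula (L : language) (V : Type) : Type :=
  | Eq of term L V & term L V
  | Rel (r : rsym L) of ('I_(rarity r) -> term L V)
  | Not of formula L V
  | And of formula L V & formula L V
  | Ex of formula L (option V).
Arguments Eq {L V}.
Arguments Rel {L V}.
Arguments Not {L V}.
Arguments And {L V}.
Arguments Ex {L V}.

Definition sentence (L : language) : Type := formula L void.

Fixpoint trename (L : language) (V W : Type) (s : V -> W) (t : term L V) :
    term L W :=
  match t with
  | Var x => Var (s x)
  | App f ts => App f (fun i => trename s (ts i))
  end.

Fixpoint rename (L : language) (V W : Type) (s : V -> W) (phi : formula L V) :
    formula L W :=
  match phi with
  | Eq t u => Eq (trename s t) (trename s u)
  | Rel r ts => Rel r (fun i => trename s (ts i))
  | Not psi => Not (rename s psi)
  | And psi chi => And (rename s psi) (rename s chi)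
  | Ex psi => Ex (rename (omap s) psi)
  end.

(* [exs m phi] is (exists x_0 ... x_(m-1)) phi. *)
Fixpoint exs (L : language) (m : nat) (V : Type) :
    formula L ('I_m + V) -> formula L V :=
  match m return formula L ('I_m + V) -> formula L V with
  | 0 => rename (fun v : 'I_0 + V =>
           match v with
           | inl i => False_rect V (notF (ltn_ord i))
           | inr w => w
           end)
  | k.+1 => fun phi => exs (Ex (rename (fun v : 'I_k.+1 + V =>
           match v with
           | inl i => omap inl (unlift ord0 i)
           | inr w => Some (inr w)
           end) phi))
  end.

Record structure (L : language) := Structure {
  carrier :> Type;
  nonempty : inhabited carrier;
  fint : forall f : fsym L, ('I_(farity f) -> carrier) -> carrier;
  rint : forall r : rsym L, ('I_(rarity r) -> carrier) -> Prop
}.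
Arguments fint {L} s f.
Arguments rint {L} s r.

Fixpoint teval (L : language) (C : structure L) (V : Type) (v : V -> C)
    (t : term L V) : C :=
  match t with
  | Var x => v x
  | App f ts => fint C f (fun i => teval v (ts i))
  end.

Fixpoint sat (L : language) (C : structure L) (V : Type) (v : V -> C)
    (phi : formula L V) : Prop :=
  match phi with
  | Eq t u => teval v t = teval v u
  | Rel r ts => rint C r (fun i => teval v (ts i))
  | Not psi => ~ sat v psi
  | And psi chi => sat v psi /\ sat v chi
  | Ex psi => exists c : C, sat (oapp v c) psi
  end.

Definition models (L : language) (C : structure L) (T : set (sentence L)) :
    Prop :=
  forall s, T s -> sat (of_void C) s.

Definition entails (L : language) (T : set (sentence L)) (s : sentence L) :
    Prop :=
  forall C : structure L, models C T -> sat (of_void C) s.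

Definition complete_theory (L : language) (T : set (sentence L)) : Prop :=
  (exists C : structure L, models C T) /\
  (forall s, entails T s \/ entails T (Not s)).

(* Sets of formulas in the variables x_0, ..., x_(n-1) with parameters in C *)
Definition ptype (L : language) (C : structure L) (n : nat) : Type :=
  set (formula L ('I_n + C)).

Definition with_params (C : Type) (n : nat) (b : 'I_n -> C) (v : 'I_n + C) : C :=
  match v with inl i => b i | inr c => c end.

Definition realizes (L : language) (C : structure L) (n : nat) (b : 'I_n -> C)
    (p : ptype C n) : Prop :=
  forall phi, p phi -> sat (with_params b) phi.

(* Consistency with the elementary diagram of C, i.e., finite satisfiability
   in C *)
Definition consistent (L : language) (C : structure L) (n : nat)
    (p : ptype C n) : Prop :=
  forall q : ptype C n, finite_set q -> q `<=` p ->
    exists b : 'I_n -> C, realizes b q.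

Definition incl_params (C : Type) (A : set C) (n : nat) (v : 'I_n + A) :
    'I_n + C :=
  match v with inl i => inl i | inr a => inr (val a) end.

Definition over (L : language) (C : structure L) (A : set C) (n : nat)
    (p : ptype C n) : Prop :=
  p `<=` range (rename (L := L) (@incl_params C A n)).

(* Cardinals are represented by arbitrary types. *)
Definition saturated (L : language) (kappa : Type) (C : structure L) : Prop :=
  forall (A : set C) (n : nat) (p : ptype C n),
    card_lt A [set: kappa] -> over A p -> consistent p ->
    exists b : 'I_n -> C, realizes b p.

Definition elementary_on (L : language) (C : structure L) (A : set C)
    (f : C -> C) : Prop :=
  forall phi : formula L A,
    sat (fun a : A => val a) phi <-> sat (fun a : A => f (val a)) phi.

Definition automorphism (L : language) (C : structure L) (g : C -> C) : Prop :=
  [/\ bijective g,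
      forall f args, g (fint C f args) = fint C f (fun i => g (args i)) &
      forall r args, rint C r args <-> rint C r (fun i => g (args i))].

Definition homogeneous (L : language) (kappa : Type) (C : structure L) : Prop :=
  forall (A : set C) (f : C -> C),
    card_lt A [set: kappa] -> elementary_on A f ->
    exists2 g : C -> C, automorphism g & forall a, A a -> g a = f a.

(* "kappa big enough" is read as kappa > |L| + aleph_0, which is the number of
   sentences of L. *)
Definition monster (L : language) (T : set (sentence L)) (kappa : Type)
    (C : structure L) : Prop :=
  [/\ models C T, card_lt [set: sentence L] [set: kappa],
      saturated kappa C & homogeneous kappa C].

(* A formula phi(x,y) with |x| = m and |y| = n is a [formula L ('I_m + 'I_n)];
   [inst phi c] is phi(x,c). *)
Definition inst (L : language) (C : structure L) (m n : nat)
    (phi : formula L ('I_m + 'I_n)) (c : 'I_n -> C) : formula L ('I_m + C) :=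
  rename (fun v : 'I_m + 'I_n =>
    match v with inl i => inl i | inr j => inr (c j) end) phi.

Definition signed (L : language) (V : Type) (b : bool) (phi : formula L V) :
    formula L V :=
  if b then phi else Not phi.

(* Finite 0-1 sequences are [seq bool]; for rho : nat -> bool, the restriction
   of rho to n is [mkseq rho n]. *)
Definition has_SOP1 (L : language) (C : structure L) : Prop :=
  exists (m n : nat) (phi : formula L ('I_m + 'I_n))
         (a : seq bool -> 'I_n -> C),
    (forall rho : nat -> bool,
       consistent (range (fun k => inst phi (a (mkseq rho k))))) /\
    (forall nu eta : seq bool, prefix (rcons nu false) eta ->
       ~ consistent [set inst phi (a eta); inst phi (a (rcons nu true))]).

Definition has_SOP1' (L : language) (C : structure L) : Prop :=
  exists (m n : nat) (phi : formula L ('I_m + 'I_n))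
         (a : seq bool -> 'I_n -> C),
    (forall eta : nat -> bool,
       consistent
         (range (fun k => signed (eta k) (inst phi (a (mkseq eta k)))))) /\
    (forall nu eta : seq bool, prefix (rcons nu false) eta ->
       ~ consistent [set inst phi (a eta); inst phi (a nu)]).

(* The formula ~ (exists x) (phi(x,y) /\ phi(x,c)) in the variables y *)
Definition excl (L : language) (C : structure L) (m n : nat)
    (phi : formula L ('I_m + 'I_n)) (c : 'I_n -> C) : formula L ('I_n + C) :=
  Not (exs (m := m) (And
    (rename (fun v : 'I_m + 'I_n =>
       match v with inl i => inl i | inr j => inr (inl j) end) phi)
    (rename (fun v : 'I_m + 'I_n =>
       match v with inl i => inl i | inr j => inr (inr (c j)) end) phi))).

Fixpoint rk_ge (L : language) (C : structure L) (m n : nat)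
    (phi : formula L ('I_m + 'I_n)) (k : nat) (p : ptype C m) (q : ptype C n) :
    Prop :=
  match k with
  | 0 => consistent p /\ consistent q
  | k'.+1 => exists c : 'I_n -> C,
      [/\ realizes c q,
          rk_ge phi k' (p `|` [set inst phi c]) q &
          rk_ge phi k' p (q `|` [set excl phi c])]
  end.

Definition rk_infinite (L : language) (C : structure L) (m n : nat)
    (phi : formula L ('I_m + 'I_n)) (p : ptype C m) (q : ptype C n) : Prop :=
  forall k, rk_ge phi k p q.

Definition rk_finite (L : language) (C : structure L) (m n : nat)
    (phi : formula L ('I_m + 'I_n)) (p : ptype C m) (q : ptype C n) : Prop :=
  ~ rk_infinite phi p q.

(* The type x = x *)
Definition trivial_type (L : language) (C : structure L) (n : nat) :
    ptype C n :=
  range (fun i : 'I_n => Eq (Var (inl i)) (Var (inl i))).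
Arguments trivial_type {L} C n.

(* Main.v *)
(** From a tree witnessing SOP_1 one gets a tree for SOP'_1 by [b_s = a_{s1}].
    Conversely, if [a] witnesses SOP'_1 then [a \o h] witnesses SOP_1, where
    [h] is given by [h (s1) = h(s)1] and [h (s0) = h(s)10]: along any branch
    of [h] each value [h s] is left through 1, and below [h (s0)] one has left
    [h (s1)] through 0.  In a tree for SOP'_1, the formulas read along a finite
    branch form a pair [(p, q)] of infinite rank.  Conversely [rk >= k] is a
    first-order property of the finitely many parameters of [p] and [q], so
    saturation provides one [c] for which both successors of a pair of infinite
    rank have infinite rank, and iterating this choice builds a tree for
    SOP'_1. *)
Require Import Defs.
From mathcomp Require Import all_boot.
From mathcomp Require Import boolp classical_sets functions cardinality.

Set Implicit Arguments.
Unset Strict Implicit.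
Unset Printing Implicit Defensive.

Local Open Scope classical_set_scope.
Local Open Scope card_scope.

(** * Satisfaction under renaming and under blocks of quantifiers *)

Definition sumv (A B C : Type) (u : A -> C) (v : B -> C) (x : A + B) : C :=
  match x with inl a => u a | inr b => v b end.

Section Satisfaction.
Variables (L : language) (C : structure L).

Lemma teval_rename (V W : Type) (s : V -> W) (v : W -> C) (t : term L V) :
  teval v (trename s t) = teval (v \o s) t.
Proof.
by elim: t => //= f ts IH; congr (fint C f _); apply: funext => i; apply: IH.
Qed.

Lemma sat_rename (V W : Type) (s : V -> W) (v : W -> C) (phi : formula L V) :
  sat v (rename s phi) = sat (v \o s) phi.
Proof.
elim: phi W s v => {V} [V t u|V r ts|V psi IH|V psi IH1 chi IH2|V psi IH]
  W s v /=.
- by rewrite !teval_rename.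
- by congr (rint C r _); apply: funext => i; rewrite teval_rename.
- by rewrite IH.
- by rewrite IH1 IH2.
- apply: eq_exists => c; rewrite IH; congr (sat _ psi).
  by apply: funext => -[].
Qed.

Lemma sat_exs (m : nat) (V : Type) (v : V -> C) (f : formula L ('I_m + V)) :
  sat v (exs f) <-> exists c : 'I_m -> C, sat (sumv c v) f.
Proof.
elim: m f => [|m IH] f.
  rewrite /= sat_rename.
  have E c : v \o (fun w : 'I_0 + V => match w with
      | inl i => False_rect V (notF (ltn_ord i)) | inr w => w end) = sumv c v.
    by apply: funext => -[[]|].
  split=> [H|[c]]; last by rewrite -E.
  by exists (fun i : 'I_0 => False_rect C (notF (ltn_ord i))); rewrite -E.
rewrite IH /=; split=> [[c [x]]|[c H]].
  (* The innermost quantifier of [exs] binds variable 0, with value [x]; the block [c] gives the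
     values of the remaining variables. *)
  rewrite sat_rename => H; exists (fun i => oapp c x (unlift ord0 i)).
  congr (sat _ f): H; apply: funext => -[i|w] //=.
  by case: (unlift ord0 i).
exists (c \o lift ord0), (c ord0); rewrite sat_rename.
congr (sat _ f): H; apply: funext => -[i|w] //=.
by case: unliftP => [j ->|->].
Qed.

Lemma sat_inst (m n : nat) (phi : formula L ('I_m + 'I_n)) (b : 'I_m -> C)
    (c : 'I_n -> C) :
  sat (with_params b) (inst phi c) = sat (sumv b c) phi.
Proof.
by rewrite /inst sat_rename; congr (sat _ phi); apply: funext => -[].
Qed.

Lemma sat_excl (m n : nat) (phi : formula L ('I_m + 'I_n)) (d c : 'I_n -> C) :
  sat (with_params d) (excl phi c) =
  ~ exists b, sat (sumv b d) phi /\ sat (sumv b c) phi.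
Proof.
rewrite /=; congr (~ _); apply: propext; rewrite sat_exs /=.
by split=> -[b bP]; exists b; move: bP; rewrite !sat_rename => bP;
  congr (_ /\ _): bP; congr (sat _ phi); apply: funext => -[].
Qed.

End Satisfaction.

(** * Finite satisfiability of types *)

Section Consistency.
Variables (L : language) (C : structure L) (n : nat).
Implicit Types p : ptype C n.

Lemma realizes_consistent p b : realizes b p -> consistent p.
Proof. by move=> bp q _ qp; exists b => f /qp/bp. Qed.

Lemma finite_consistent p :
  finite_set p -> consistent p <-> exists b, realizes b p.
Proof.
by move=> pfin; split=> [cp|[b /realizes_consistent]//]; apply: cp.
Qed.

Lemma consistent_pair (f g : formula L ('I_n + C)) :
  consistent [set f; g] <->
  exists b, sat (with_params b) f /\ sat (with_params b) g.
Proof.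
rewrite finite_consistent; last exact: finite_set2.
split=> -[b H]; exists b; first by split; apply: H; [left|right].
by case: H => bf bg h [->|->].
Qed.

(** A finite set of formulas [F k] has bounded indices, so it is enough to realize initial
    segments. *)
Lemma consistent_range (F : nat -> formula L ('I_n + C)) :
  consistent (range F) <->
  forall N, exists b, forall k, k < N -> sat (with_params b) (F k).
Proof.
split=> [cF N|H q qfin qF].
  have [|_ [k _ <-]|b bF] := cF (F @` `I_N).
  - exact/finite_image/finite_II.
  - by exists k.
  - by exists b => k kN; apply: bF; exists k.
(* [idx] picks one index for each formula of the range; the value 0 elsewhere is a dummy. *)
have /choice[idx idxP] (f : formula L ('I_n + C)) :
    exists k, range F f -> F k = f.
  have [[k _ <-]|nf] := pselect (range F f); first by exists k.
  by exists 0.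
have /finite_seqP[s sE] : finite_set (idx @` q) by exact: finite_image.
have [b bP] := H (\max_(i <- s) i).+1.
exists b => f qf; rewrite -(idxP _ (qF _ qf)); apply: bP.
rewrite ltnS; apply: (@leq_bigmax_seq _ s xpredT id) => //.
have : (idx @` q) (idx f) by exists f.
by rewrite sE.
Qed.

Lemma realizesU1 p f b :
  realizes b (p `|` [set f]) = (realizes b p /\ sat (with_params b) f).
Proof.
apply: propext; split=> [H|[bp bf] g [/bp//|->//]].
by split=> [g pg|]; apply: H; [left|right].
Qed.

Lemma realizes_trivial b : realizes b (@trivial_type L C n).
Proof. by move=> _ [i _ <-]. Qed.

Lemma finite_trivial_type : finite_set (@trivial_type L C n).
Proof. exact/finite_image/finite_finset. Qed.

End Consistency.

(** * Rank and trees for an abstract relation *)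

Section AbstractRank.
Variables (B D : Type) (Phi : B -> D -> Prop).

Definition clash (d c : D) : Prop := exists b, Phi b d /\ Phi b c.

(** This is [rk_ge] with each type replaced by the set of its realizations and consistency by
    nonemptiness. *)
Fixpoint rank_ge (k : nat) (P : B -> Prop) (Q : D -> Prop) : Prop :=
  match k with
  | 0 => (exists b, P b) /\ (exists d, Q d)
  | k'.+1 => exists c, [/\ Q c, rank_ge k' (fun b => P b /\ Phi b c) Q &
                            rank_ge k' P (fun d => Q d /\ ~ clash d c)]
  end.

Lemma rank_ge_sub k (P P' : B -> Prop) (Q Q' : D -> Prop) :
  (forall b, P b -> P' b) -> (forall d, Q d -> Q' d) ->
  rank_ge k P Q -> rank_ge k P' Q'.
Proof.
elim: k P P' Q Q' => [|k IH] P P' Q Q' PP QQ /=.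
  by move=> [[b /PP Pb] [d /QQ Qd]]; split; [exists b|exists d].
move=> [c [/QQ Qc H1 H0]]; exists c; split=> //.
  by apply: IH H1 => // b [/PP].
by apply: IH H0 => // d [/QQ].
Qed.

Lemma rank_geSW k P Q : rank_ge k.+1 P Q -> rank_ge k P Q.
Proof.
elim: k P Q => [|k IH] P Q /=.
  by move=> [c [Qc [[b [Pb _]] _] _]]; split; [exists b|exists c].
by move=> [c [Qc /IH H1 /IH H0]]; exists c.
Qed.

Lemma rank_ge_le j k P Q : j <= k -> rank_ge k P Q -> rank_ge j P Q.
Proof.
move=> /subnK <-; elim: (k - j) => [//|i IH].
by rewrite addSn => /rank_geSW.
Qed.

(** That [rcons t x] is a prefix of [s] means that [s] leaves [t] through [x]. Finite branches
    suffice because consistency is finite satisfiability. *)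
Definition sop1'_tree (a : seq bool -> D) : Prop :=
  (forall s, exists b, forall t x, prefix (rcons t x) s -> (Phi b (a t) <-> x))
  /\ (forall nu eta, prefix (rcons nu false) eta -> ~ clash (a eta) (a nu)).

Lemma prefix_rcons_rcons (t s : seq bool) x y :
  prefix (rcons t x) (rcons s y) ->
  prefix (rcons t x) s \/ (t = s /\ x = y).
Proof.
move=> /prefixP[u]; elim/last_ind: u => [|u z _].
  by rewrite cats0 => /rcons_inj[-> ->]; right.
rewrite -rcons_cat => /rcons_inj[-> _]; left; exact: prefix_prefix.
Qed.

(** Each node is its own witness: [a s] clashes with no node that [s] leaves through 0, and the
    pairs attached to the children of [s] are contained in the two successors of the pair at [s]. *)
Lemma sop1'_tree_rank a : sop1'_tree a ->
  forall k, rank_ge k (fun=> True) (fun=> True).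
Proof.
move=> [branch out] k.
pose P s b := forall t, prefix (rcons t true) s -> Phi b (a t).
pose Q s d := forall t, prefix (rcons t false) s -> ~ clash d (a t).
suff H s : rank_ge k (P s) (Q s) by apply: rank_ge_sub (H [::]).
elim: k s => [|k IH] s /=.
  split; last by exists (a s) => t; exact: out.
  by have [b bP] := branch s; exists b => t ts; apply/(bP t true).
exists (a s); split; first by move=> t; exact: out.
  apply: rank_ge_sub (IH (rcons s true)) => [b bP|d dQ t ts].
    split=> [t ts|]; last exact/bP/prefix_refl.
    apply/bP/(prefix_trans ts)/prefix_rcons.
  exact/dQ/(prefix_trans ts)/prefix_rcons.
apply: rank_ge_sub (IH (rcons s false)) => [b bP t ts|d dQ].
  exact/bP/(prefix_trans ts)/prefix_rcons.
split=> [t ts|]; last exact/dQ/prefix_refl.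
exact/dQ/(prefix_trans ts)/prefix_rcons.
Qed.

(* [good] will be "infinite rank and definable over finitely many parameters". *)
Lemma sop1'_tree_of_step (good : (B -> Prop) -> (D -> Prop) -> Prop) :
  good (fun=> True) (fun=> True) ->
  (forall P Q, good P Q -> exists c, [/\ Q c,
     good (fun b => P b /\ Phi b c) Q &
     good P (fun d => Q d /\ ~ clash d c)]) ->
  (forall P Q, good P Q -> exists b, P b) ->
  exists a, sop1'_tree a.
Proof.
move=> good0 goodS goodP.
(* Default value of the choice function outside good pairs. *)
have [d0 _] := goodS _ _ good0.
pose S := ((B -> Prop) * (D -> Prop))%type.
have /choice[c cP] (PQ : S) : exists c, good PQ.1 PQ.2 -> [/\ PQ.2 c,
     good (fun b => PQ.1 b /\ Phi b c) PQ.2 &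
     good PQ.1 (fun d => PQ.2 d /\ ~ clash d c)].
  have [/goodS[c ?]|] := pselect (good PQ.1 PQ.2); first by exists c.
  by exists d0.
pose step (PQ : S) (x : bool) : S :=
  if x then (fun b => PQ.1 b /\ Phi b (c PQ), PQ.2)
  else (PQ.1, fun d => PQ.2 d /\ ~ clash d (c PQ)).
pose st s := foldl step (fun=> True, fun=> True) s.
have stS s x : st (rcons s x) = step (st s) x by rewrite /st foldl_rcons.
have goodst s : good (st s).1 (st s).2.
  by elim/last_ind: s => [//|s [] /cP[Qc ? ?]]; rewrite stS.
have stP s t b : prefix (rcons t true) s -> (st s).1 b -> Phi b (c (st t)).
  elim/last_ind: s => [|s x IH]; first by case: t.
  move=> /prefix_rcons_rcons[ts|[-> <-]]; rewrite stS; last by case.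
  by case: x ts => [ts /= [Ps _]|ts Ps]; exact: IH.
have stQ s t d : prefix (rcons t false) s -> (st s).2 d -> ~ clash d (c (st t)).
  elim/last_ind: s => [|s x IH]; first by case: t.
  move=> /prefix_rcons_rcons[ts|[-> <-]]; rewrite stS; last by case.
  by case: x ts => [ts Qs|ts /= [Qs _]]; exact: IH.
have Qc s : (st s).2 (c (st s)) by case: (cP _ (goodst s)).
exists (c \o st); split=> [s|nu eta pre]; last exact: stQ pre (Qc eta).
(* Prolonging the branch by 1 makes [b] satisfy the formula at [s], which
   refutes the formulas at the nodes left through 0. *)
have [b bP] := goodP _ _ (goodst (rcons s true)).
exists b => t x tx; split=> [bt|].
  case: x tx => // ts; case: (stQ _ _ _ ts (Qc s)).
  by exists b; split=> //; apply: stP bP; exact: prefix_refl.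
by case: x tx => // ts _; apply: stP bP; apply: prefix_trans ts (prefix_rcons _ _).
Qed.

Definition sop1_tree (a : seq bool -> D) : Prop :=
  (forall s, exists b, forall t, prefix t s -> Phi b (a t)) /\
  (forall nu eta, prefix (rcons nu false) eta ->
     ~ clash (a eta) (a (rcons nu true))).

(** The negated instances come from inconsistency: a branch leaving [t] through 0 satisfies the
    formula at [t0], which excludes the one at [t1]. *)
Lemma sop1_tree_sop1' a : sop1_tree a -> exists a', sop1'_tree a'.
Proof.
move=> [branch out]; exists (fun s => a (rcons s true)).
split=> [s|nu eta pre]; last first.
  by apply: out; apply: prefix_trans pre (prefix_rcons _ _).
have [b bP] := branch s; exists b => t [] ts; first by split=> // _; exact: bP.
split=> // bt; case: (out t (rcons t false)); first exact: prefix_refl.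
by exists b; split=> //; exact: bP.
Qed.

Definition detour (s : seq bool) : seq bool :=
  flatten [seq (if x then [:: true] else [:: true; false]) | x <- s].

Lemma detour_rcons s x :
  detour (rcons s x) =
  if x then rcons (detour s) true else rcons (rcons (detour s) true) false.
Proof.
by rewrite /detour map_rcons flatten_rcons; case: x; rewrite -?cats1 -?catA.
Qed.

Lemma prefix_detour s t : prefix s t -> prefix (detour s) (detour t).
Proof.
by move=> /prefixP[u ->]; rewrite /detour map_cat flatten_cat prefix_prefix.
Qed.

Lemma sop1'_tree_sop1 a : sop1'_tree a -> sop1_tree (a \o detour).
Proof.
move=> [branch out]; split=> [s|nu eta pre].
  (* The final 1 makes the branch leave [detour s] through 1 as well, which covers the case
     [t = s]. *)
  have [b bP] := branch (rcons (detour s) true); exists b => t /prefixP[u su].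
  apply/(bP (detour t) true) => //; rewrite {}su; case: u => [|x u].
    by rewrite cats0 prefix_refl.
  rewrite -cat_rcons; apply: prefix_trans (prefix_rcons _ _).
  (* Whatever the next letter [x] is, its code begins with 1. *)
  have /prefix_detour : prefix (rcons t x) (rcons t x ++ u).
    exact: prefix_prefix.
  rewrite detour_rcons; apply: prefix_trans; case: x; first exact: prefix_refl.
  exact: prefix_rcons.
(* The code of [nu0] is the code of [nu1] followed by 0. *)
apply: out; move/prefix_detour: pre.
by rewrite !detour_rcons.
Qed.

End AbstractRank.

(** * Definability of the rank, and saturation *)

Section Definability.
Variables (L : language) (C : structure L).

Definition definable (V : Type) (P : (V -> C) -> Prop) : Prop :=
  exists f : formula L V, forall v : V -> C, sat v f <-> P v.

(** One formula defines the sets for all parameters [v]. A witness [c] can thus become a further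
    parameter, over ['I_n + V], and then be quantified away. *)
Definition definable_family (m : nat) (V : Type)
    (P : (V -> C) -> ('I_m -> C) -> Prop) : Prop :=
  definable (fun w : 'I_m + V -> C => P (w \o inr) (w \o inl)).

Lemma definable_comp (V W : Type) (s : V -> W) (P : (V -> C) -> Prop) :
  definable P -> definable (fun w => P (w \o s)).
Proof. by move=> [f fP]; exists (rename s f) => w; rewrite sat_rename. Qed.

Lemma definable_not (V : Type) (P : (V -> C) -> Prop) :
  definable P -> definable (fun v => ~ P v).
Proof. by move=> [f fP]; exists (Not f) => v /=; rewrite fP. Qed.

Lemma definable_and (V : Type) (P Q : (V -> C) -> Prop) :
  definable P -> definable Q -> definable (fun v => P v /\ Q v).
Proof. by move=> [f fP] [g gQ]; exists (And f g) => v /=; rewrite fP gQ. Qed.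

Lemma definable_true (V : Type) : definable (fun _ : V -> C => True).
Proof.
exists (Ex (Eq (Var None) (Var None))) => v; split=> // _.
by case: (Defs.nonempty C) => c; exists c.
Qed.

Lemma definable_ex (V : Type) (n : nat) (P : (V -> C) -> ('I_n -> C) -> Prop) :
  definable_family P -> definable (fun v => exists c, P v c).
Proof.
move=> [f fP]; exists (exs f) => v; rewrite sat_exs.
by split=> -[c cP]; exists c; apply/(fP (sumv c v)).
Qed.

Lemma definable_family_weaken (m n : nat) (V : Type)
    (P : (V -> C) -> ('I_m -> C) -> Prop) :
  definable_family P ->
  definable_family (fun w : 'I_n + V -> C => P (w \o inr)).
Proof.
exact: (definable_comp (fun x : 'I_m + V =>
  match x with inl i => inl i | inr y => inr (inr y) end)).
Qed.

Variables (m n : nat) (phi : formula L ('I_m + 'I_n)).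

Definition phi_rel (b : 'I_m -> C) (c : 'I_n -> C) : Prop :=
  sat (sumv b c) phi.

Lemma definable_phi_rel (V : Type) (s : 'I_m -> V) (t : 'I_n -> V) :
  definable (fun v => phi_rel (v \o s) (v \o t)).
Proof.
exists (rename (sumv s t) phi) => v; rewrite sat_rename /phi_rel.
by have -> : v \o sumv s t = sumv (v \o s) (v \o t) by apply: funext => -[].
Qed.

Lemma definable_clash (V : Type) (s t : 'I_n -> V) :
  definable (fun v => clash phi_rel (v \o s) (v \o t)).
Proof.
apply: (definable_ex (P := fun v b => phi_rel b (v \o s) /\ phi_rel b (v \o t))).
exact: definable_and (definable_phi_rel inl (inr \o s))
                     (definable_phi_rel inl (inr \o t)).
Qed.

Section Step.
Variables (V : Type) (P : (V -> C) -> ('I_m -> C) -> Prop).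
Variable (Q : (V -> C) -> ('I_n -> C) -> Prop).
Hypotheses (dP : definable_family P) (dQ : definable_family Q).

Lemma definable_family_phi : definable_family
  (fun (w : 'I_n + V -> C) b => P (w \o inr) b /\ phi_rel b (w \o inl)).
Proof.
apply: definable_and; first exact: definable_family_weaken dP.
exact: (definable_phi_rel inl (inr \o inl)).
Qed.

Lemma definable_family_clash : definable_family
  (fun (w : 'I_n + V -> C) d => Q (w \o inr) d /\ ~ clash phi_rel d (w \o inl)).
Proof.
apply: definable_and; first exact: definable_family_weaken dQ.
exact/definable_not/(definable_clash inl (inr \o inl)).
Qed.

End Step.

(** The condition on [c] under the quantifier in [rank_ge k.+1], isolated so that one [c] can be
    sought for all [k]. *)
Definition rank_step k (P : ('I_m -> C) -> Prop) (Q : ('I_n -> C) -> Prop) c :=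
  [/\ Q c, rank_ge phi_rel k (fun b => P b /\ phi_rel b c) Q &
      rank_ge phi_rel k P (fun d => Q d /\ ~ clash phi_rel d c)].

(** For fixed [k] the rank unfolds into finitely many quantifiers; at each level the successors are
    again families, with [c] among the parameters. *)
Lemma definable_rank_step (k : nat) (V : Type)
    (P : (V -> C) -> ('I_m -> C) -> Prop)
    (Q : (V -> C) -> ('I_n -> C) -> Prop) :
  definable_family P -> definable_family Q ->
  definable_family (fun v => rank_step k (P v) (Q v)).
Proof.
have conj3 V' (X Y Z : (V' -> C) -> Prop) : definable X -> definable Y ->
    definable Z -> definable (fun v => [/\ X v, Y v & Z v]).
  move=> dX dY dZ; have [f fP] := definable_and dX (definable_and dY dZ).
  by exists f => v; rewrite fP; split=> [[? []]|[]].
elim: k V P Q => [|k IH] V P Q dP dQ; (apply: conj3; first exact: dQ).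
- apply: definable_and; apply: definable_ex.
    exact: definable_family_phi.
  exact: definable_family_weaken dQ.
- apply: definable_and; apply: definable_ex.
    exact: definable_family_weaken dP.
  exact: definable_family_clash.
- apply: definable_ex; apply: IH; first exact: definable_family_phi.
  exact: definable_family_weaken dQ.
- apply: definable_ex; apply: IH; first exact: definable_family_weaken dP.
  exact: definable_family_clash.
Qed.

(** Finiteness of [V] keeps the parameter set small for saturation and is preserved when the tuple
    [c] is added. *)
Definition definable_infinite_rank (P : ('I_m -> C) -> Prop)
    (Q : ('I_n -> C) -> Prop) : Prop :=
  (forall k, rank_ge phi_rel k P Q) /\
  exists (V : finType) (v : V -> C) P' Q',
    [/\ definable_family P', definable_family Q', P = P' v & Q = Q' v].

(** Iterated negations of one sentence are distinct. So a [kappa] exceeding the number of sentences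
    is uncountable, and finite parameter sets are small. *)
Lemma nat_le_sentence : [set: nat] #<= [set: sentence L].
Proof.
pose base : sentence L := Ex (Eq (Var None) (Var None)).
have inj : {in [set: nat] &, injective (fun k => iter k Not base)}.
  move=> i j _ _; elim: i j => [|i IH] [|j] //= [] ij.
  by congr _.+1; apply: IH.
have := inj_card_eq inj; rewrite card_eq_le => /andP[_ /card_le_trans]; apply.
exact: card_leT.
Qed.

Lemma saturated_realizes (kappa : Type) (V : finType) (v : V -> C)
    (h : nat -> formula L ('I_n + V)) :
  card_lt [set: sentence L] [set: kappa] -> saturated kappa C ->
  (forall N, exists c, forall k, k < N -> sat (sumv c v) (h k)) ->
  exists c, forall k, sat (sumv c v) (h k).
Proof.
move=> [Lk kL] satC hsat.
pose A : set C := range v.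
have vA x : A (v x) by exists x.
pose u (x : V) : A := SigSub (mem_set (vA x)).
pose F k := rename (@incl_params C A n) (rename (fun x : 'I_n + V =>
  match x with inl i => inl i | inr y => inr (u y) end) (h k)).
have FE k c : sat (with_params c) (F k) = sat (sumv c v) (h k).
  by rewrite /F !sat_rename; congr (sat _ (h k)); apply: funext => -[].
have [] : exists c, realizes c (range F).
  apply: (satC A).
  - have AL : A #<= [set: sentence L].
      apply: card_le_trans nat_le_sentence.
      exact/finite_set_countable/finite_image/finite_finset.
    split; first exact: card_le_trans AL Lk.
    by move=> /card_le_trans/(_ AL).
  - by move=> _ [k _ <-]; eexists.
  - apply/consistent_range => N; have [c cP] := hsat N.
    by exists c => k /cP; rewrite FE.
by move=> c cF; exists c => k; rewrite -FE; apply: cF; exists k.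
Qed.

Lemma definable_infinite_rank_step (kappa : Type) P Q :
  card_lt [set: sentence L] [set: kappa] -> saturated kappa C ->
  definable_infinite_rank P Q -> exists c,
    [/\ Q c, definable_infinite_rank (fun b => P b /\ phi_rel b c) Q &
        definable_infinite_rank P (fun d => Q d /\ ~ clash phi_rel d c)].
Proof.
move=> Lk satC [inf [V [v [P' [Q' [dP dQ PE QE]]]]]].
have [c cG] : exists c, forall k, rank_step k P Q c.
  have /choice[h hG] k := definable_rank_step k dP dQ.
  have hE k c : sat (sumv c v) (h k) <-> rank_step k P Q c by rewrite hG PE QE.
  have [|c cP] := @saturated_realizes kappa V v h Lk satC.
    (* A witness for rank [N.+1] satisfies the conditions for all [k < N], as these weaken when [k]
       decreases. *)
    move=> N; have [c [Qc r1 r0]] := inf N.+1; exists c => k /ltnW kN.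
    by apply/hE; split=> //; apply: rank_ge_le kN _.
  by exists c => k; apply/hE.
exists c; split; first by case: (cG 0).
- split=> [k|]; first by case: (cG k).
  (* The parameters of a successor are the old ones together with [c]. *)
  exists ('I_n + V)%type, (sumv c v); do 2 eexists; split.
  + exact: definable_family_phi dP.
  + exact: definable_family_weaken dQ.
  + by rewrite PE.
  + by rewrite QE.
- split=> [k|]; first by case: (cG k).
  exists ('I_n + V)%type, (sumv c v); do 2 eexists; split.
  + exact: definable_family_weaken dP.
  + exact: definable_family_clash dQ.
  + by rewrite PE.
  + by rewrite QE.
Qed.

Lemma infinite_rank_sop1' (kappa : Type) :
  card_lt [set: sentence L] [set: kappa] -> saturated kappa C ->
  (forall k, rank_ge phi_rel k (fun=> True) (fun=> True)) ->
  exists a, sop1'_tree phi_rel a.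
Proof.
move=> Lk satC inf; apply: (sop1'_tree_of_step (good := definable_infinite_rank)).
- split=> //; exists void, (of_void C), (fun _ _ => True), (fun _ _ => True).
  by split=> //; exact: definable_true.
- by move=> P Q; apply: definable_infinite_rank_step Lk satC.
- by move=> P Q [/(_ 0)[]].
Qed.

(** Each step adds one formula, so the types stay finite, and a finite type is consistent exactly
    when it is realized. *)
Lemma rk_geE k (p : ptype C m) (q : ptype C n) :
  finite_set p -> finite_set q ->
  rk_ge phi k p q = rank_ge phi_rel k (fun b => realizes b p) (fun d => realizes d q).
Proof.
elim: k p q => [|k IH] p q fp fq /=; apply: propext.
  by rewrite !finite_consistent.
suff E c : [/\ realizes c q, rk_ge phi k (p `|` [set inst phi c]) q &
      rk_ge phi k p (q `|` [set excl phi c])] =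
    rank_step k (fun b => realizes b p) (fun d => realizes d q) c.
  by split=> -[c cP]; exists c; move: cP; rewrite E.
rewrite !IH ?finite_setU //; try by split=> //; exact: finite_set1.
have -> : (fun b => realizes b (p `|` [set inst phi c])) =
    (fun b => realizes b p /\ phi_rel b c).
  by apply: funext => b; rewrite realizesU1 sat_inst.
have -> : (fun d => realizes d (q `|` [set excl phi c])) =
    (fun d => realizes d q /\ ~ clash phi_rel d c).
  by apply: funext => d; rewrite realizesU1 sat_excl.
by [].
Qed.

Lemma rk_infiniteE :
  rk_infinite phi (trivial_type C m) (trivial_type C n) <->
  forall k, rank_ge phi_rel k (fun=> True) (fun=> True).
Proof.
split=> H k; move: (H k); rewrite rk_geE; try exact: finite_trivial_type.
  exact: rank_ge_sub.
by apply: rank_ge_sub => b _; exact: realizes_trivial.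
Qed.

End Definability.

(** * From branches in the definitions to finite sequences *)

Lemma consistent_inst_pair (L : language) (C : structure L) (m n : nat)
    (phi : formula L ('I_m + 'I_n)) (d c : 'I_n -> C) :
  consistent [set inst phi d; inst phi c] <-> clash (phi_rel phi) d c.
Proof.
by rewrite consistent_pair; split=> -[b bP]; exists b; move: bP;
  rewrite !sat_inst.
Qed.

Lemma prefix_mkseq (T : eqType) (x0 : T) (s t : seq T) :
  prefix t s -> t = mkseq (nth x0 s) (size t).
Proof.
move=> /prefixP[u ->]; apply: (@eq_from_nth _ x0) => [|i it].
  by rewrite size_mkseq.
by rewrite nth_mkseq // nth_cat it.
Qed.

Lemma prefix_mkseq_leq (T : eqType) (r : nat -> T) k N :
  k <= N -> prefix (mkseq r k) (mkseq r N).
Proof.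
move=> /subnK <-; rewrite addnC /mkseq iotaD map_cat; exact: prefix_prefix.
Qed.

(** A finite sequence is padded with 0 to an infinite branch; conversely, each initial segment of a
    branch is handled by a finite sequence. *)
Lemma has_SOP1E (L : language) (C : structure L) :
  has_SOP1 C <-> exists (m n : nat) (phi : formula L ('I_m + 'I_n))
    (a : seq bool -> 'I_n -> C), sop1_tree (phi_rel phi) a.
Proof.
split=> -[m [n [phi [a [branch out]]]]]; exists m, n, phi, a; split.
- move=> s; have /consistent_range/(_ (size s).+1)[b bP] := branch (nth false s).
  exists b => t ts; rewrite (prefix_mkseq false ts) /phi_rel -sat_inst.
  by apply: bP; rewrite ltnS size_prefix.
- by move=> nu eta /out H /consistent_inst_pair.
- move=> rho; apply/consistent_range => N; have [b bP] := branch (mkseq rho N).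
  exists b => k /ltnW kN; rewrite sat_inst; exact/bP/prefix_mkseq_leq.
- by move=> nu eta /out H /consistent_inst_pair.
Qed.

Lemma has_SOP1'E (L : language) (C : structure L) :
  has_SOP1' C <-> exists (m n : nat) (phi : formula L ('I_m + 'I_n))
    (a : seq bool -> 'I_n -> C), sop1'_tree (phi_rel phi) a.
Proof.
have sat_signed (V : Type) (v : V -> C) (x : bool) (f : formula L V) :
    sat v (signed x f) <-> (sat v f <-> x).
  case: x; split=> [fv|[fx xf]] //=; first exact: xf.
  by move=> /fx.
split=> -[m [n [phi [a [branch out]]]]]; exists m, n, phi, a; split.
(* A node that [s] leaves is shorter than [s], so the bound is [size s]; for SOP_1 the node [s]
   itself counts too, whence the successor there. *)
- move=> s; have /consistent_range/(_ (size s))[b bP] := branch (nth false s).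
  exists b => t x ts; have := prefix_mkseq false ts.
  rewrite size_rcons mkseqS => /rcons_inj[tE ->].
  rewrite /phi_rel -sat_inst {1}tE; apply/sat_signed/bP.
  by have := size_prefix ts; rewrite size_rcons.
- by move=> nu eta /out H /consistent_inst_pair.
- move=> rho; apply/consistent_range => N; have [b bP] := branch (mkseq rho N).
  exists b => k kN; apply/sat_signed; rewrite sat_inst; apply: bP.
  by rewrite -mkseqS; exact: prefix_mkseq_leq.
- by move=> nu eta /out H /consistent_inst_pair.
Qed.

Theorem corollary2p9 (L : language) (T : set (sentence L))
    (hT : complete_theory T) (kappa : Type) (C : structure L)
    (hC : monster T kappa C) :
  [<-> ~ has_SOP1 C;
       ~ has_SOP1' C;
       forall (m n : nat) (phi : formula L ('I_m + 'I_n)),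
         rk_finite phi (trivial_type C m) (trivial_type C n)].
Proof.
case: hC => _ Lk satC _.
split; [|split].
- move=> nsop /has_SOP1'E[m [n [phi [a ha]]]]; apply/nsop/has_SOP1E.
  by exists m, n, phi, (a \o detour); exact: sop1'_tree_sop1.
- move=> nsop m n phi /rk_infiniteE/(infinite_rank_sop1' Lk satC)[a ha].
  by apply/nsop/has_SOP1'E; exists m, n, phi, a.
(* The cycle closes through an SOP'_1 tree, which forces infinite rank. *)
- move=> fin /has_SOP1E[m [n [phi [a /sop1_tree_sop1'[a' ha']]]]].
  by apply: (fin m n phi); apply/rk_infiniteE/sop1'_tree_rank; exact: ha'.
Qed.
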